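(* Let $\mathscr{B}=\mathscr{B}(\lambda)$ be the boundary measurement matrix of the pentagram network $Q_n$ with non-commutative weights $X_i,Y_i,Z$, and write $\mathrm{tr}(\mathscr{B}^i)=\sum_k t_{ik}\lambda^k$ for $i\ge1$. Then for each $i$ and $j$, the class $t_{ij}^\natural$ (modulo commutators) is invariant under both the non-commutative pentagram map $T$ and its modified version $\widehat{T}=S^2\circ T$, where $S$ is the shift of indices by one.
   Context: Let $X_1,\dots,X_n,Y_1,\dots,Y_n,Z$ be formal non-commuting variables, $\mathcal{F}$ the free skew field over $\mathbb{Q}$ (universal field of fractions of the free associative algebra) they generate, and $\mathscr{L}_\bullet\subset\mathcal{F}$ the subalgebra generated by these variables and their inverses. For an algebra $A$, $A^\natural=A/[A,A]$ is the quotient by the linear span of commutators and $a^\natural$ is the class of $a$. Invariance of $t^\natural$ under a map means that the image of $t$ is equal to $t$ modulo commutators. The non-commutative pentagram map $T$ is the substitution $$X_i\mapsto (X_i+Y_i)^{-1}X_i(X_{i+2}+Y_{i+2}),\qquad Y_i\mapsto (X_{i+1}+Y_{i+1})^{-1}Y_{i+1}(X_{i+3}+Y_{i+3}),\qquad Z\mapsto Z,$$ where an index exceeding $n$ is interpreted by $X_{i+n}=ZX_iZ^{-1}$, $Y_{i+n}=ZY_iZ^{-1}$. The shift $S$ is $S(X_i)=X_{i-1}$, $S(Y_i)=Y_{i-1}$ with indices read cyclically (mod $n$) and $S(Z)=Z$. The modified map is $\widehat{T}=S^2\circ T$, i.e. $T$ followed by a shift of the indices by $2$. The network $Q_n$.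 It has $n$ square faces; face $i$ has vertices $tl_i,tr_i,bl_i,br_i$ (top-left, top-right, bottom-left, bottom-right) and arrows $bl_i\to tl_i$ of weight $X_i$, $bl_i\to br_i$ of weight $Y_i$, $tl_i\to tr_i$ and $tr_i\to br_i$ of weight $1$. There are further arrows $br_i\to tl_{i+1}$ and $tr_i\to bl_{i+2}$ of weight $1$ whenever both faces have index at most $n$. Sources $1,2,3$ on one boundary circle of a cylinder have arrows of weight $1$ to $tl_1,bl_1,bl_2$ respectively; sinks $1,2,3$ on the other boundary circle receive arrows of weight $Z$ from $br_n,tr_{n-1},tr_n$ respectively. The cut. The cylinder is drawn as a rectangle with top and bottom edges identified, sources on the left side and sinks on the right side; the cut is the identified top/bottom edge, oriented from left to right. In the drawing the faces are placed from left to right on three horizontal strands, each face one strand lower than the previous one; for each face $i$ with $i$ divisible by $3$, the arrow $br_{i-1}\to tl_i$ leaves through the bottom edge and re-enters from the top edge, and the arrow leaving $tr_i$ towards $bl_{i+2}$ (or towards the corresponding sink) leaves through the top edge and re-enters from the bottom edge; no other arrow meets the cut. The variable $\lambda$ commutes with everything; an arrow crossing the cut downward has its weight multiplied by $\lambda$, an arrow crossing it upward by $\lambda^{-1}$. The $(s,t)$ entry of $\mathscr{B}(\lambda)$ is the sum over all directed paths from source $s$ to sink $t$ of the product, from left to right, of these modified edge weights; entries lie in $\mathscr{L}_\bullet[\lambda^{\pm1}]$.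
   Formalization: The shift S is read with the twist X_{i+n}=ZX_iZ^{-1}, so S(X_1)=Z^{-1}X_nZ (likewise Y), not X_n; and if 3 does not divide n, one more arrow meets the cut: br_n to sink 1 (downward) for n=2 mod 3, tr_n to sink 3 (upward) for n=1 mod 3. As literally stated the claim fails. *)

(* Defs.v *)
From HB Require Import structures.
From mathcomp Require Import all_boot all_order all_algebra.
From mathcomp Require Import finmap.
From mathcomp.multinomials Require Import monalg.

Set Implicit Arguments.
Unset Strict Implicit.
Unset Printing Implicit Defensive.

Import GRing.Theory Num.Theory.
Local Open Scope ring_scope.

(* Laurent polynomials in a central variable [lambda] over a possibly
   non-commutative ring: finitely supported maps from exponents to coefficients.
   The multiplication of [monalg] does not apply, since it asks for monomials
   without nontrivial units. *)
Section Laurent.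
Variable R : nzRingType.

Definition laurent := {malg R[int]}.
HB.instance Definition _ := GRing.Zmodule.on laurent.

Implicit Types (p q : laurent).

(* c * lambda ^ k *)
Definition lterm (c : R) (k : int) : laurent := mkmalgU k c.

Definition lcoef (p : laurent) (k : int) : R := mcoeff k p.

Definition lmul p q : laurent :=
  \sum_(a <- msupp p) \sum_(b <- msupp q) lterm (lcoef p a * lcoef q b) (a + b).

Definition lone : laurent := lterm 1 0.

Lemma lterm0 k : lterm 0 k = 0.
Proof. exact: monalgU0. Qed.

Lemma ltermD c d k : lterm (c + d) k = lterm c k + lterm d k.
Proof. exact: monalgUD. Qed.

Lemma lmulw (d1 d2 : {fset int}) p q :
  (msupp p `<=` d1)%fset -> (msupp q `<=` d2)%fset ->
  lmul p q
    = \sum_(a <- d1) \sum_(b <- d2) lterm (lcoef p a * lcoef q b) (a + b).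
Proof.
move=> s1 s2; rewrite /lmul (big_fset_incl _ s1) /=.
  apply: eq_bigr => a _; apply: big_fset_incl => // b _ /mcoeff_outdom qb.
  by rewrite /lcoef qb mulr0 lterm0.
move=> a _ /mcoeff_outdom pa.
by rewrite big1 // => b _; rewrite /lcoef pa mul0r lterm0.
Qed.

Lemma lmulDl : left_distributive lmul +%R.
Proof.
move=> p p' q; set d := (msupp p `|` msupp p')%fset.
rewrite (lmulw (d1 := d) (d2 := msupp q)) ?msuppD_le //.
rewrite (lmulw (p := p) (d1 := d) (d2 := msupp q)) ?fsubsetUl //.
rewrite (lmulw (p := p') (d1 := d) (d2 := msupp q)) ?fsubsetUr //.
rewrite -big_split; apply: eq_bigr => a _ /=.
rewrite -big_split; apply: eq_bigr => b _ /=.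
by rewrite -ltermD -mulrDl /lcoef mcoeffD.
Qed.

Lemma lmulDr : right_distributive lmul +%R.
Proof.
move=> q p p'; set d := (msupp p `|` msupp p')%fset.
rewrite (lmulw (d1 := msupp q) (d2 := d)) ?msuppD_le //.
rewrite (lmulw (q := p) (d1 := msupp q) (d2 := d)) ?fsubsetUl //.
rewrite (lmulw (q := p') (d1 := msupp q) (d2 := d)) ?fsubsetUr //.
rewrite -big_split; apply: eq_bigr => a _ /=.
rewrite -big_split; apply: eq_bigr => b _ /=.
by rewrite -ltermD -mulrDr /lcoef mcoeffD.
Qed.

Lemma lmul0p p : lmul 0 p = 0.
Proof. by apply: (addIr (lmul 0 p)); rewrite -lmulDl !add0r. Qed.

Lemma lmulp0 p : lmul p 0 = 0.
Proof. by apply: (addIr (lmul p 0)); rewrite -lmulDr !add0r. Qed.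

Lemma lmul_terms c d a b :
  lmul (lterm c a) (lterm d b) = lterm (c * d) (a + b).
Proof.
rewrite (lmulw (d1 := [fset a]%fset) (d2 := [fset b]%fset)) ?msuppU_le //.
by rewrite !big_seq_fset1 /lcoef /lterm !mcoeffUU.
Qed.

Lemma laurentE p : p = \sum_(a <- msupp p) lterm (lcoef p a) a.
Proof. exact: monalgE. Qed.

Lemma lmul_suml I (r : seq I) (E : I -> laurent) q :
  lmul (\sum_(i <- r) E i) q = \sum_(i <- r) lmul (E i) q.
Proof. exact: (big_morph (lmul^~ q) (fun _ _ => lmulDl _ _ _) (lmul0p _)). Qed.

Lemma lmul_sumr I (r : seq I) (E : I -> laurent) q :
  lmul q (\sum_(i <- r) E i) = \sum_(i <- r) lmul q (E i).
Proof. exact: (big_morph (lmul q) (fun _ _ => lmulDr _ _ _) (lmulp0 _)). Qed.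

Lemma lmulA : associative lmul.
Proof.
move=> p q r; rewrite [p]laurentE !lmul_suml; apply: eq_bigr => a _.
rewrite [q]laurentE lmul_suml !lmul_sumr lmul_suml; apply: eq_bigr => b _.
rewrite [r]laurentE !lmul_sumr; apply: eq_bigr => c _.
by rewrite !lmul_terms mulrA addrA.
Qed.

Lemma lmul1p : left_id lone lmul.
Proof.
move=> p; rewrite [p]laurentE lmul_sumr; apply: eq_bigr => a _.
by rewrite lmul_terms mul1r add0r.
Qed.

Lemma lmulp1 : right_id lone lmul.
Proof.
move=> p; rewrite [p]laurentE lmul_suml; apply: eq_bigr => a _.
by rewrite lmul_terms mulr1 addr0.
Qed.

Lemma lone_neq0 : lone != 0.
Proof.
apply/eqP => /malgP /(_ 0) /eqP.
by rewrite /lone /lterm mcoeffUU mcoeff0 oner_eq0.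
Qed.

HB.instance Definition _ := GRing.Zmodule_isNzRing.Build laurent
  lmulA lmul1p lmulp1 lmulDl lmulDr lone_neq0.

End Laurent.

Definition skew_field (K : unitRingType) : Prop :=
  forall x : K, x != 0 -> x \is a GRing.unit.

(* P. M. Cohn's notion of specialization between R-fields: a homomorphism of
   R-rings [phi] from an R-subring [K0] of K to L, such that the elements of K0
   outside the kernel are invertible in K0. Values of [phi] outside [K0] are
   irrelevant. *)
Record specialization (R : nzRingType) (K L : unitRingType)
    (f : {rmorphism R -> K}) (g : {rmorphism R -> L})
    (K0 : K -> Prop) (phi : K -> L) : Prop := Specialization {
  spec_base : forall r, K0 (f r);
  spec_sub : forall x y, K0 x -> K0 y -> K0 (x - y);
  spec_mul : forall x y, K0 x -> K0 y -> K0 (x * y);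
  spec_morph_base : forall r, phi (f r) = g r;
  spec_morph_sub : forall x y, K0 x -> K0 y -> phi (x - y) = phi x - phi y;
  spec_morph_mul : forall x y, K0 x -> K0 y -> phi (x * y) = phi x * phi y;
  spec_local : forall x, K0 x -> phi x != 0 -> x \is a GRing.unit /\ K0 x^-1 }.

(* In a unitRingType the inverse of a non-unit x is x itself, so closure under
   inversion is only a condition on units. *)
Definition generated_as_field (R : nzRingType) (K : unitRingType)
    (f : {rmorphism R -> K}) : Prop :=
  forall P : K -> Prop,
    (forall r, P (f r)) ->
    (forall x y, P x -> P y -> P (x - y)) ->
    (forall x y, P x -> P y -> P (x * y)) ->
    (forall x, P x -> P x^-1) ->
  forall x, P x.

(* Cohn's definition, by specializations to all R-fields. *)
Definition universal_field_of_fractions (R : nzRingType) (K : unitRingType)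
    (f : {rmorphism R -> K}) : Prop :=
  [/\ skew_field K, injective f, generated_as_field f
    & forall (L : unitRingType) (g : {rmorphism R -> L}), skew_field L ->
        exists (K0 : K -> Prop) (phi : K -> L), specialization f g K0 phi].

(* The variables X_1..X_n, Y_1..Y_n, Z; the ordinal i stands for index i.+1. *)
Definition variable (n : nat) : Type := ('I_n + 'I_n + unit)%type.
HB.instance Definition _ n := Choice.on (variable n).

Definition free_algebra (n : nat) := {malg rat[{fmonom (variable n)}]}.
HB.instance Definition _ n := GRing.NzRing.on (free_algebra n).

Definition gen n (v : variable n) : free_algebra n := mkmalgU (fmu v) 1.
Definition genX n (i : 'I_n) : free_algebra n := gen (inl (inl i)).
Definition genY n (i : 'I_n) : free_algebra n := gen (inl (inr i)).
Definition genZ n : free_algebra n := gen (inr tt).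

(* Equality in A / [A, A], with [A, A] the linear span of the commutators. *)
Definition eq_mod_commutators (k : fieldType) (A : algType k) (a b : A) : Prop :=
  exists s : seq (k * (A * A)),
    a - b = \sum_(p <- s) p.1 *: (p.2.1 * p.2.2 - p.2.2 * p.2.1).

Section PentagramMap.
Variables (n : nat) (F : unitRingType).

Lemma cyclic_index_subproof (i : 'I_n) (k : int) :
  (`|((i%:Z + k) %% n%:Z)%Z| < n)%N.
Proof.
have n0 : n%:Z != 0 by case: i => i /=; case: (n).
by rewrite -ltz_nat gez0_abs ?modz_ge0 // ltz_pmod //; case: (n) n0.
Qed.

Definition cyclic_index (i : 'I_n) (k : int) : 'I_n :=
  Ordinal (cyclic_index_subproof i k).

(* A_(i + k) for an arbitrary integer k, with A_(j + n) = Z * A_j * Z^-1. *)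
Definition twisted (A : 'I_n -> F) (Z : F) (i : 'I_n) (k : int) : F :=
  let m := ((i%:Z + k) %/ n%:Z)%Z in Z ^ m * A (cyclic_index i k) * Z ^ (- m).

Variables (X Y : 'I_n -> F) (Z : F).

Definition is_pentagram_map (T : {rmorphism F -> F}) : Prop :=
  let x := twisted X Z in
  let y := twisted Y Z in
  [/\ forall i, T (X i) = (x i 0 + y i 0)^-1 * x i 0 * (x i 2 + y i 2),
      forall i, T (Y i) = (x i 1 + y i 1)^-1 * y i 1 * (x i 3 + y i 3)
    & T Z = Z].

(* Indices are cyclic in the sense of [twisted], so S(X_1) = Z^-1 * X_n * Z.
   With S(X_1) = X_n the classes below are not invariant under S. *)
Definition is_shift (S : {rmorphism F -> F}) : Prop :=
  [/\ forall i, S (X i) = twisted X Z i (-1),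
      forall i, S (Y i) = twisted Y Z i (-1)
    & S Z = Z].

End PentagramMap.

Inductive corner : predArgType := TL | TR | BL | BR.

Definition corner_code (c : corner) : 'I_4 :=
  match c with
  | TL => inord 0 | TR => inord 1 | BL => inord 2 | BR => inord 3
  end.

Definition corner_decode (k : 'I_4) : corner :=
  nth TL [:: TL; TR; BL; BR] k.

Lemma corner_codeK : cancel corner_code corner_decode.
Proof. by case; rewrite /corner_decode /= inordK. Qed.

HB.instance Definition _ := Finite.copy corner (can_type corner_codeK).

(* Source s, Sink s and Face i stand for the numbers s.+1 and i.+1. *)
Inductive vertex (n : nat) : predArgType :=
  Source of 'I_3 | Sink of 'I_3 | Face of 'I_n & corner.
Arguments Source {n}.
Arguments Sink {n}.

Definition vertex_code n (v : vertex n) : 'I_3 + 'I_3 + 'I_n * corner :=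
  match v with
  | Source s => inl (inl s) | Sink s => inl (inr s) | Face i c => inr (i, c)
  end.

Definition vertex_decode n (w : 'I_3 + 'I_3 + 'I_n * corner) : vertex n :=
  match w with
  | inl (inl s) => Source s | inl (inr s) => Sink s | inr (i, c) => Face i c
  end.

Lemma vertex_codeK n : cancel (@vertex_code n) (@vertex_decode n).
Proof. by case. Qed.

HB.instance Definition _ n := Finite.copy (vertex n) (can_type (@vertex_codeK n)).

Section Network.
Variables (n : nat) (F : nzRingType) (X Y : 'I_n -> F) (Z : F).

Definition when (b : bool) (w : F) (e : int) : option (F * int) :=
  if b then Some (w, e) else None.

(* [edge u v] is [Some (w, e)] if there is an arrow u -> v, of weight w, whose
   signed number of crossings of the cut is e: an arrow crossing downward
   counts 1, an arrow crossing upward counts -1.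

   The sinks 1, 2, 3 stand at the same heights of the rectangle as the sources
   1, 2, 3. If 3 divides n this is where the strands end. Otherwise the last
   arrows have to rotate by one strand: down if n = 2 mod 3, where br_n is on
   the lowest strand and the arrow to sink 1 crosses the cut downward, and up
   if n = 1 mod 3, where the arrow to sink 3 crosses the cut upward. Without
   these crossings the cut does not close up when each sink is identified with
   the source of the same number, as is done in the traces of powers. *)
Definition edge (u v : vertex n) : option (F * int) :=
  match u, v with
  | Face i BL, Face j TL => when (i == j) (X i) 0
  | Face i BL, Face j BR => when (i == j) (Y i) 0
  | Face i TL, Face j TR => when (i == j) 1 0
  | Face i TR, Face j BR => when (i == j) 1 0
  | Face i BR, Face j TL =>
      when (j == i.+1 :> nat) 1 (if (3 %| j.+1)%N then 1 else 0)
  | Face i TR, Face j BL =>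
      when (j == i.+2 :> nat) 1 (if (3 %| i.+1)%N then -1 else 0)
  | Source s, Face i TL => when ((s.+1 == 1) && (i.+1 == 1))%N 1 0
  | Source s, Face i BL =>
      when ((s.+1 == 2) && (i.+1 == 1) || (s.+1 == 3) && (i.+1 == 2))%N 1 0
  | Face i BR, Sink s =>
      when ((s.+1 == 1) && (i.+1 == n))%N Z (if (3 %| n.+1)%N then 1 else 0)
  | Face i TR, Sink s =>
      if (s.+1 == 2)%N then
        when (i.+2 == n) Z (if (3 %| i.+1)%N then -1 else 0)
      else
        when ((s.+1 == 3) && (i.+1 == n))%N Z
             (if (3 %| n)%N || (3 %| n.-1)%N then -1 else 0)
  | _, _ => None
  end.

Definition arrow : rel (vertex n) := fun u v => isSome (edge u v).

Definition edge_weight (u v : vertex n) : laurent F :=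
  if edge u v is Some (w, e) then lterm w e else 0.

Fixpoint path_weight (u : vertex n) (p : seq (vertex n)) : laurent F :=
  if p is v :: p' then edge_weight u v * path_weight v p' else 1.

(* The network is acyclic, so a directed path has fewer than #|vertex n|
   arrows. A path is given by its starting point and the vertices after it. *)
Definition boundary_measurement : 'M[laurent F]_3 :=
  \matrix_(s < 3, t < 3)
    \sum_(k < #|vertex n|)
      \sum_(p : k.-tuple (vertex n)
             | path arrow (Source s) p && (last (Source s) p == Sink t))
        path_weight (Source s) p.

Definition trace_coef (i : nat) (j : int) : F :=
  lcoef (\tr (boundary_measurement ^+ i)) j.

End Network.

(* Main.v *)
(* Let s_k = x_k + y_k, with indices continued by conjugation by Z. Up to a
   diagonal gauge, B(lambda) is M_1 ... M_n lambda^m Z, where M_k is the transfer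
   matrix of face k, with x_k, y_k rescaled by lambda^-1. The pentagram map acts
   by M_k |-> H_k^-1 M_k H_(k+1) with H_(n+1) = Z H_1 Z^-1, hence by conjugation
   on the product, and the shift permutes the factors cyclically. Traces of
   powers are unchanged modulo commutators in both cases.

   That T and S exist as endomorphisms of the free skew field is an instance of:
   a substitution extends as soon as it has a left inverse substitution. *)
From HB Require Import structures.
From mathcomp Require Import all_boot all_order all_algebra.
From mathcomp Require Import finmap.
From mathcomp.multinomials Require Import monalg.
From mathcomp Require Import zify.
Require Import Defs.

Set Implicit Arguments.
Unset Strict Implicit.
Unset Printing Implicit Defensive.

Import GRing.Theory.
Local Open Scope ring_scope.

(** * Commutators and traces over Laurent polynomials *)

(** Since lambda is central, a commutator of Laurent polynomials has sums of commutators as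
    coefficients, so conjugating a matrix changes the coefficients of traces of powers only by such
    sums. The variables are extended to sequences on all integers; the closing condition at index
    n+1 is then an instance of quasiperiodicity. H_k arises from a change of unknowns in the linear
    recursion for path sums, and is invertible because x_k + y_k and y_k are units. For existence,
    universality only gives specializations on local subrings, possibly proper ones; this is what
    the left inverse substitution repairs. *)

Section CommutatorSums.
Variable A : pzRingType.

(** Scalars can be absorbed into a factor of a commutator. Leaving them out makes the notion visibly
    stable under ring morphisms. *)
Definition commutator_sum (x : A) : Prop :=
  exists s : seq (A * A), x = \sum_(p <- s) (p.1 * p.2 - p.2 * p.1).

Lemma commutator_sum0 : commutator_sum 0.
Proof. by exists [::]; rewrite big_nil. Qed.

Lemma commutator_sumC (x y : A) : commutator_sum (x * y - y * x).
Proof. by exists [:: (x, y)]; rewrite big_seq1. Qed.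

Lemma commutator_sumD x y :
  commutator_sum x -> commutator_sum y -> commutator_sum (x + y).
Proof. by move=> [s ->] [t ->]; exists (s ++ t); rewrite big_cat. Qed.

Lemma commutator_sumN x : commutator_sum x -> commutator_sum (- x).
Proof.
move=> [s ->]; exists [seq (p.2, p.1) | p <- s].
by rewrite big_map -sumrN; apply: eq_bigr => p _; rewrite opprB.
Qed.

Lemma commutator_sum_big I (r : seq I) (P : pred I) (E : I -> A) :
  (forall i, P i -> commutator_sum (E i)) ->
  commutator_sum (\sum_(i <- r | P i) E i).
Proof.
by move=> h; elim/big_ind: _ => //; [exact: commutator_sum0|exact: commutator_sumD].
Qed.

Lemma commutator_sum_rmorph (T : {rmorphism A -> A}) x :
  commutator_sum x -> commutator_sum (T x).
Proof.
move=> [s ->]; exists [seq (T p.1, T p.2) | p <- s].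
by rewrite big_map rmorph_sum; apply: eq_bigr => p _; rewrite rmorphB !rmorphM.
Qed.

End CommutatorSums.

Lemma eq_mod_commutatorsP (k : fieldType) (A : algType k) (a b : A) :
  commutator_sum (a - b) -> eq_mod_commutators a b.
Proof.
move=> [s es]; exists [seq (1, p) | p <- s].
by rewrite es big_map; apply: eq_bigr => p _; rewrite scale1r.
Qed.

Lemma exprS_mulC (A : pzRingType) (p q : A) k :
  (p * q) ^+ k.+1 = p * ((q * p) ^+ k * q).
Proof.
elim: k => [|k ih]; first by rewrite expr1 expr0 mul1r.
by rewrite exprSr ih exprSr !mulrA.
Qed.

Section LaurentTraces.
Variable F : nzRingType.
Implicit Types (p q : laurent F).

Lemma lcoef_sum I (r : seq I) (P : pred I) (E : I -> laurent F) j :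
  lcoef (\sum_(i <- r | P i) E i) j = \sum_(i <- r | P i) lcoef (E i) j.
Proof. by rewrite /lcoef raddf_sum. Qed.

Lemma lcoefB p q j : lcoef (p - q) j = lcoef p j - lcoef q j.
Proof. exact: mcoeffB. Qed.

Lemma lcoef_lterm (c : F) k j : lcoef (lterm c k) j = c *+ (k == j).
Proof. exact: mcoeffU. Qed.

(** The index sets need only contain the supports, so that products of polynomials with different
    supports can be compared term by term. *)
Lemma lcoefM p q (d1 d2 : {fset int}) j :
  (msupp p `<=` d1)%fset -> (msupp q `<=` d2)%fset ->
  lcoef (p * q) j
    = \sum_(a <- d1) \sum_(b <- d2) (lcoef p a * lcoef q b) *+ (a + b == j).
Proof.
move=> pd qd; rewrite [p * q](lmulw pd qd) lcoef_sum; apply: eq_bigr => a _.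
by rewrite lcoef_sum; apply: eq_bigr => b _; rewrite lcoef_lterm.
Qed.

Lemma ltermM (c d : F) a b : lterm c a * lterm d b = lterm (c * d) (a + b).
Proof. exact: lmul_terms. Qed.

Definition coef_commutators p : Prop := forall j, commutator_sum (lcoef p j).

Lemma coef_commutatorsC p q : coef_commutators (p * q - q * p).
Proof.
move=> j; rewrite lcoefB (lcoefM (d1 := msupp p) (d2 := msupp q)) //.
rewrite (lcoefM (d1 := msupp q) (d2 := msupp p)) // exchange_big /= -sumrB.
apply: commutator_sum_big => a _; rewrite -sumrB; apply: commutator_sum_big => b _.
rewrite [b + a]addrC; case: eqP => _ /=; rewrite ?mulr1n ?mulr0n ?subrr.
  exact: commutator_sumC.
exact: commutator_sum0.
Qed.

Lemma coef_commutators_sum I (r : seq I) (E : I -> laurent F) :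
  (forall i, coef_commutators (E i)) -> coef_commutators (\sum_(i <- r) E i).
Proof. by move=> h j; rewrite lcoef_sum; apply: commutator_sum_big => i _; apply: h. Qed.

Lemma mxtrace_mulC_mod m n (P : 'M[laurent F]_(m, n)) (Q : 'M[laurent F]_(n, m)) :
  coef_commutators (\tr (P *m Q) - \tr (Q *m P)).
Proof.
rewrite /mxtrace; under eq_bigr do rewrite mxE.
under [X in _ - X]eq_bigr do rewrite mxE.
rewrite exchange_big -sumrB; apply: coef_commutators_sum => i /=.
by rewrite -sumrB; apply: coef_commutators_sum => j; apply: coef_commutatorsC.
Qed.

(** For k > 0 and M = (QP)^(k-1) Q, the two powers are PM and MP. *)
Lemma mxtrace_exprC_mod n (P Q : 'M[laurent F]_n.+1) k :
  coef_commutators (\tr ((P * Q) ^+ k) - \tr ((Q * P) ^+ k)).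
Proof.
case: k => [|k]; first by move=> j; rewrite !expr0 subrr /lcoef mcoeff0; apply: commutator_sum0.
have -> : (P * Q) ^+ k.+1 = P *m ((Q * P) ^+ k * Q) by rewrite exprS_mulC.
have -> : (Q * P) ^+ k.+1 = ((Q * P) ^+ k * Q) *m P by rewrite exprSr mulrA.
by move: ((Q * P) ^+ k * Q) => M; apply: mxtrace_mulC_mod.
Qed.

Lemma mxtrace_expr_conj_mod n (P P' Q R : 'M[laurent F]_n.+1) k :
  Q *m R = 1%:M -> R *m Q = 1%:M -> P *m Q = Q *m P' ->
  coef_commutators (\tr (P' ^+ k) - \tr (P ^+ k)).
Proof.
move=> QR RQ PQ.
have -> : P' = R * (P *m Q) by rewrite PQ -mulmxE mulmxA RQ mul1mx.
have {2}-> : P = (P *m Q) * R by rewrite -mulmxE -mulmxA QR mulmx1.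
exact: mxtrace_exprC_mod.
Qed.

Section CoefficientwiseImage.
Variable T : {rmorphism F -> F}.

(** The action of [T] on coefficients with lambda fixed, kept as a relation compatible with sums and
    products, which avoids building a morphism of Laurent polynomials. *)
Definition coef_image p p' : Prop := forall j, lcoef p' j = T (lcoef p j).

Lemma coef_image0 : coef_image 0 0.
Proof. by move=> j; rewrite /lcoef mcoeff0 rmorph0. Qed.

Lemma coef_image_lterm c k : coef_image (lterm c k) (lterm (T c) k).
Proof. by move=> j; rewrite !lcoef_lterm rmorphMn. Qed.

Lemma coef_image_sum I (r : seq I) (P : pred I) (E E' : I -> laurent F) :
  (forall i, P i -> coef_image (E i) (E' i)) ->
  coef_image (\sum_(i <- r | P i) E i) (\sum_(i <- r | P i) E' i).
Proof.
by move=> h j; rewrite !lcoef_sum rmorph_sum; apply: eq_bigr => i Pi; apply: h.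
Qed.

Lemma coef_imageM p p' q q' :
  coef_image p p' -> coef_image q q' -> coef_image (p * q) (p' * q').
Proof.
move=> hp hq j.
rewrite (lcoefM (d1 := (msupp p `|` msupp p')%fset)
  (d2 := (msupp q `|` msupp q')%fset)) ?fsubsetUr //.
rewrite (lcoefM (d1 := (msupp p `|` msupp p')%fset)
  (d2 := (msupp q `|` msupp q')%fset)) ?fsubsetUl //.
rewrite rmorph_sum; apply: eq_bigr => a _; rewrite rmorph_sum; apply: eq_bigr => b _.
by rewrite rmorphMn rmorphM hp hq.
Qed.

(** [T] preserves sums of commutators, so invariance passes from [q] to any [p] congruent to it; the
    image of [p] is never computed. *)
Lemma lcoef_image_invariant p q q' j :
  coef_commutators (p - q) -> coef_image q q' -> coef_commutators (q' - q) ->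
  commutator_sum (T (lcoef p j) - lcoef p j).
Proof.
move=> /(_ j) pq /(_ j) Tq /(_ j); rewrite !lcoefB Tq in pq * => q'q.
have -> : T (lcoef p j) - lcoef p j = T (lcoef p j - lcoef q j)
    + (T (lcoef q j) - lcoef q j) - (lcoef p j - lcoef q j).
  by rewrite rmorphB opprB !addrA !subrK.
apply: commutator_sumD; last exact: commutator_sumN.
by apply: commutator_sumD => //; apply: commutator_sum_rmorph.
Qed.

Definition mx_coef_image m n (P P' : 'M[laurent F]_(m, n)) : Prop :=
  forall i j, coef_image (P i j) (P' i j).

Lemma mx_coef_imageM m n r (P P' : 'M[laurent F]_(m, n)) (Q Q' : 'M_(n, r)) :
  mx_coef_image P P' -> mx_coef_image Q Q' ->
  mx_coef_image (P *m Q) (P' *m Q').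
Proof.
by move=> hP hQ i j; rewrite !mxE; apply: coef_image_sum => k _; apply: coef_imageM.
Qed.

Lemma mx_coef_image1 n : mx_coef_image 1%:M (1%:M : 'M_n).
Proof.
move=> i j; rewrite !mxE; case: (i == j); last exact: coef_image0.
by have := coef_image_lterm 1 0; rewrite rmorph1 mulr1n.
Qed.

Lemma mx_coef_image_prod n m (P P' : nat -> 'M[laurent F]_n.+1) :
  (forall i, mx_coef_image (P i) (P' i)) ->
  mx_coef_image (\prod_(i < m) P i) (\prod_(i < m) P' i).
Proof.
move=> h; elim: m => [|m ih]; first by rewrite !big_ord0; apply: mx_coef_image1.
by rewrite !big_ord_recr; apply: mx_coef_imageM.
Qed.

Lemma coef_image_mxtrace_expr n (P P' : 'M[laurent F]_n.+1) k :
  mx_coef_image P P' -> coef_image (\tr (P ^+ k)) (\tr (P' ^+ k)).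
Proof.
move=> hP; apply: coef_image_sum => i _.
(* The two indices of a diagonal entry are separated, because the induction needs all entries. *)
elim: k i {2 4}i => [|k ih] i j; first exact: mx_coef_image1.
by rewrite !exprS; apply: mx_coef_imageM.
Qed.

End CoefficientwiseImage.
End LaurentTraces.

(** * Substitutions in the free skew field *)

Section FreeAlgebra.
Variables (n : nat) (L : unitAlgType rat) (v : variable n -> L).

Definition word_eval (m : {fmonom (variable n)}) : L := \prod_(i <- (m : seq _)) v i.

Lemma word_eval_mmorphism : mmorphism word_eval.
Proof.
split=> [x y|]; first by rewrite /word_eval fmM big_cat.
by rewrite /word_eval fm1 big_nil.
Qed.

HB.instance Definition _ :=
  monalg.isMultiplicative.Build {fmonom (variable n)} L word_eval word_eval_mmorphism.

Definition free_eval : free_algebra n -> L := mmap (in_alg L) word_eval.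

Lemma free_eval_monoid_morphism : monoid_morphism free_eval.
Proof.
have [h1 h2] : multiplicative free_eval.
  by apply: commr_mmap_is_multiplicative => g m m'; rewrite /GRing.comm /= mulr_algl mulr_algr.
by split.
Qed.

HB.instance Definition _ := GRing.Additive.copy free_eval (mmap (in_alg L) word_eval).
HB.instance Definition _ :=
  GRing.isMonoidMorphism.Build (free_algebra n) L free_eval free_eval_monoid_morphism.

Lemma free_eval_gen u : free_eval (gen u) = v u.
Proof. by rewrite /free_eval /gen mmapU /= scale1r mul1r /word_eval fmU big_seq1. Qed.

End FreeAlgebra.

Lemma free_algebra_ind n (P : free_algebra n -> Prop) :
  (forall c : rat, P (malgC c)) -> (forall v, P (gen v)) ->
  (forall x y, P x -> P y -> P (x - y)) ->
  (forall x y, P x -> P y -> P (x * y)) ->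
  forall r, P r.
Proof.
move=> PC Pgen PB PM r.
have P0 : P 0 by rewrite -(subrr (malgC 1 : free_algebra n)); apply: PB.
have PD x y : P x -> P y -> P (x + y).
  by move=> Px Py; rewrite -[y]opprK; apply: (PB _ _ Px); rewrite -sub0r; apply: PB.
have PU (s : seq (variable n)) : P (mkmalgU (FMonom s) 1).
  elim: s => [|v s ih]; first by rewrite -fmE -/(fmone _); apply: PC.
  suff -> : mkmalgU (FMonom (v :: s)) 1 = gen v * mkmalgU (FMonom s) 1 by apply: PM.
  rewrite /gen [RHS]fgmulUU mulr1; congr (mkmalgU _ _).
  by apply: val_inj; rewrite /= -/(mmul _ _) fmM fmU.
rewrite [r]monalgE; elim/big_ind: _ => // -[s] _.
suff -> : mkmalgU (FMonom s) r@_(FMonom s) = malgC r@_(FMonom s) * mkmalgU (FMonom s) 1.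
  exact: PM.
by rewrite [RHS]fgmulUU mulr1 mul1m.
Qed.

(** Additive maps between rational vector spaces are Q-linear, so a bare ring morphism respects
    rational scalars. *)
Lemma rmorph_malgC n (L : algType rat) (f : {rmorphism free_algebra n -> L}) (c : rat) :
  f (malgC c) = c%:A.
Proof.
pose u (c : rat^o) : L := f (malgC c).
have uB : zmod_morphism u by move=> x y; rewrite /u monalgUB rmorphB.
by have := rat_linear uB c 1; rewrite {2}/u rmorph1 => <-; rewrite -[in LHS](mulr1 c).
Qed.

Section Specializations.
Variables (R : nzRingType) (K L : unitRingType).
Variables (f : {rmorphism R -> K}) (g : {rmorphism R -> L}).
Variables (K0 : K -> Prop) (phi : K -> L).
Hypothesis sp : specialization f g K0 phi.

Lemma spec0 : K0 0 /\ phi 0 = 0.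
Proof.
rewrite -(rmorph0 f); split; first exact: (spec_base sp).
by rewrite (spec_morph_base sp) !rmorph0.
Qed.

Lemma spec1 : K0 1 /\ phi 1 = 1.
Proof.
rewrite -(rmorph1 f); split; first exact: (spec_base sp).
by rewrite (spec_morph_base sp) !rmorph1.
Qed.

Lemma specD x y : K0 x -> K0 y -> K0 (x + y) /\ phi (x + y) = phi x + phi y.
Proof.
move=> Kx Ky; have [K00 phi0] := spec0; rewrite -[y]opprK -[- y]sub0r.
have Kny : K0 (0 - y) := spec_sub sp K00 Ky.
split; first exact: (spec_sub sp).
by rewrite (spec_morph_sub sp) // (spec_morph_sub sp) // phi0 !sub0r !opprK.
Qed.

Lemma specM x y : K0 x -> K0 y -> K0 (x * y) /\ phi (x * y) = phi x * phi y.
Proof.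
by move=> Kx Ky; split; [apply: (spec_mul sp)|apply: (spec_morph_mul sp)].
Qed.

Lemma specV x : K0 x -> phi x \is a GRing.unit ->
  [/\ x \is a GRing.unit, K0 x^-1 & phi x^-1 = (phi x)^-1].
Proof.
move=> Kx uphi.
have phix0 : phi x != 0 by apply: contraTneq uphi => ->; rewrite unitr0.
have [ux Kxi] := spec_local sp Kx phix0; split=> //.
by apply: (mulrI uphi); rewrite -(spec_morph_mul sp) // !divrr // spec1.2.
Qed.

Lemma specX x k : K0 x -> phi x \is a GRing.unit ->
  K0 (x ^ k) /\ phi (x ^ k) = phi x ^ k.
Proof.
move=> Kx uphi; have [ux Kxi phixi] := specV Kx uphi.
have nat_case z m : K0 z -> K0 (z ^+ m) /\ phi (z ^+ m) = phi z ^+ m.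
  move=> Kz; elim: m => [|m [Km phim]]; first exact: spec1.
  by rewrite !exprS -phim; apply: specM.
case: k => m; first exact: nat_case.
by rewrite !NegzE -!exprz_inv -phixi; apply: nat_case.
Qed.

End Specializations.

Section Universal.
Variables (R : nzRingType) (F : unitRingType) (iota : {rmorphism R -> F}).
Hypothesis hF : universal_field_of_fractions iota.

(* [phi] extends [g] on a local subring K0, and [psi] is a left inverse of
   [phi] on [iota R]. The elements of K0 where [psi] inverts [phi] are closed
   under inversion, because nothing but 0 is sent to 0: so K0 is everything. *)
Lemma universal_endomorphism (g h : {rmorphism R -> F}) :
  (forall K0 phi, specialization iota h K0 phi ->
     forall r, K0 (g r) /\ phi (g r) = iota r) ->
  exists T : {rmorphism F -> F}, forall r, T (iota r) = g r.
Proof.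
case: hF => skewF _ genF univ ginv.
have [K0 [phi sp]] := univ F g skewF.
have [K1 [psi sp']] := univ F h skewF.
have all : forall x, [/\ K0 x, K1 (phi x) & psi (phi x) = x].
  apply: genF.
  - move=> r; have [Kgr egr] := ginv _ _ sp' r.
    by rewrite (spec_morph_base sp); split=> //; apply: (spec_base sp).
  - move=> x y [Kx K1x ex] [Ky K1y ey]; rewrite (spec_morph_sub sp) //.
    rewrite (spec_morph_sub sp') // ex ey.
    by split=> //; [apply: (spec_sub sp)|apply: (spec_sub sp')].
  - move=> x y [Kx K1x ex] [Ky K1y ey]; rewrite (spec_morph_mul sp) //.
    rewrite (spec_morph_mul sp') // ex ey.
    by split=> //; [apply: (spec_mul sp)|apply: (spec_mul sp')].
  - move=> x [Kx K1x ex].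
    (* Closure under inversion includes 0, whose inverse is 0 by convention. *)
    have [->|x0] := eqVneq x 0.
      rewrite invr0 (spec0 sp).2 (spec0 sp').2.
      by split=> //; [exact: (spec0 sp).1|exact: (spec0 sp').1].
    have psix0 : psi (phi x) != 0 by rewrite ex.
    have phix0 : phi x != 0.
      by apply: contraNneq psix0 => ->; rewrite (spec0 sp').2.
    have [_ Kxi ->] := specV sp Kx (skewF _ phix0).
    have [_ K1xi ->] := specV sp' K1x (skewF _ psix0).
    by rewrite ex.
have phiB : zmod_morphism phi.
  by move=> x y; rewrite (spec_morph_sub sp) //; [case: (all x)|case: (all y)].
have phiM : monoid_morphism phi.
  split; first exact: (spec1 sp).2.
  by move=> x y; rewrite (spec_morph_mul sp) //; [case: (all x)|case: (all y)].
pose TB := GRing.isZmodMorphism.Build F F phi phiB.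
pose TM := GRing.isMonoidMorphism.Build F F phi phiM.
pose T : {rmorphism F -> F} := HB.pack phi TB TM.
by exists T => r; apply: (spec_morph_base sp).
Qed.

End Universal.

(** * Quasiperiodic sequences of variables *)

Section Unrolling.
Variables (n : nat) (n0 : (0 < n)%N) (F : unitRingType).
Implicit Types (A : 'I_n -> F) (Z : F).

Definition unroll A Z (k : int) : F := twisted A Z (Ordinal n0) k.

Lemma twistedE A Z i k : twisted A Z i k = unroll A Z (i%:Z + k).
Proof.
rewrite /unroll /twisted /= add0r; congr (_ * A _ * _); apply: val_inj => /=.
by rewrite add0r.
Qed.

Definition quasiperiodic Z (f : int -> F) : Prop :=
  forall k q : int, f (k + q * n%:Z) = Z ^ q * f k * Z ^ (- q).

(** A quasiperiodic sequence is determined by n consecutive values. This extends the formulas for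
    the maps from the generators to all integer indices. *)
Lemma eq_unroll A Z f : quasiperiodic Z f -> (forall i : 'I_n, f i%:Z = A i) ->
  forall k, unroll A Z k = f k.
Proof.
move=> qf fA k; rewrite {2}(divz_eq k n%:Z) addrC qf /unroll /twisted /= add0r.
rewrite -fA /= gez0_abs ?modz_ge0 //; first by rewrite add0r.
by case: (n) n0.
Qed.

Variable Z : F.
Hypothesis uZ : Z \is a GRing.unit.

Lemma conj_exprzM q (x y : F) :
  Z ^ q * (x * y) * Z ^ (- q) = (Z ^ q * x * Z ^ (- q)) * (Z ^ q * y * Z ^ (- q)).
Proof.
have e : Z ^ (- q) * Z ^ q = 1 by rewrite -exprzDr // addNr expr0z.
by rewrite -!mulrA [Z ^ (- q) * _]mulrA e mul1r.
Qed.

Lemma quasiperiodicD f g : quasiperiodic Z f -> quasiperiodic Z g ->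
  quasiperiodic Z (fun k => f k + g k).
Proof. by move=> qf qg k q; rewrite qf qg mulrDr mulrDl. Qed.

Lemma quasiperiodicM f g : quasiperiodic Z f -> quasiperiodic Z g ->
  quasiperiodic Z (fun k => f k * g k).
Proof. by move=> qf qg k q; rewrite qf qg conj_exprzM. Qed.

Lemma quasiperiodicV f : (forall k, f k \is a GRing.unit) ->
  quasiperiodic Z f -> quasiperiodic Z (fun k => (f k)^-1).
Proof.
move=> uf qf k q; apply: (mulrI (uf (k + q * n%:Z))); rewrite divrr //.
rewrite qf -conj_exprzM divrr // mulr1 -exprzDr // subrr expr0z //.
Qed.

Lemma quasiperiodic_shift f c : quasiperiodic Z f ->
  quasiperiodic Z (fun k => f (k + c)).
Proof. by move=> qf k q; rewrite addrAC qf. Qed.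

Lemma unroll_quasiperiodic A : quasiperiodic Z (unroll A Z).
Proof.
move=> k q; rewrite /unroll /twisted /= !add0r [k + _]addrC divzMDl; last by case: (n) n0.
rewrite opprD [- q + _]addrC !exprzDr // !mulrA; congr (_ * A _ * _ * _).
by apply: val_inj; rewrite /= !add0r modzMDl.
Qed.

Lemma unroll_ord A (i : 'I_n) : unroll A Z i%:Z = A i.
Proof.
have i_range : (0 <= i%:Z < `|n%:Z|)%R by rewrite /= ltz_nat.
rewrite /unroll /twisted /= add0r divz_small // expr0z mul1r mulr1.
by congr A; apply: val_inj; rewrite /= add0r modz_small.
Qed.

Lemma unroll_rmorph (T : {rmorphism F -> F}) A k :
  T (unroll A Z k) = unroll (T \o A) (T Z) k.
Proof. by rewrite /unroll /twisted !rmorphM !rmorphXz. Qed.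

Section Maps.
Variables X Y : 'I_n -> F.
Let x := unroll X Z.
Let y := unroll Y Z.
Let s k := x k + y k.

Lemma pentagram_unroll (T : {rmorphism F -> F}) :
  (forall k, s k \is a GRing.unit) -> is_pentagram_map X Y Z T ->
  forall k, T (x k) = (s k)^-1 * x k * s (k + 2) /\
            T (y k) = (s (k + 1))^-1 * y (k + 1) * s (k + 3).
Proof.
move=> us [TX TY TZ] k; rewrite !unroll_rmorph TZ.
have qx : quasiperiodic Z x by apply: unroll_quasiperiodic.
have qy : quasiperiodic Z y by apply: unroll_quasiperiodic.
have qs : quasiperiodic Z s by apply: quasiperiodicD.
have qsV : quasiperiodic Z (fun k => (s k)^-1) by apply: quasiperiodicV.
split.
  apply: (eq_unroll (f := fun k => (s k)^-1 * x k * s (k + 2))) => [|i].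
    apply: quasiperiodicM; first exact: quasiperiodicM.
    exact: quasiperiodic_shift.
  by rewrite /= TX !twistedE addr0.
apply: (eq_unroll (f := fun k => (s (k + 1))^-1 * y (k + 1) * s (k + 3))) => [|i].
  apply: quasiperiodicM; last exact: quasiperiodic_shift.
  by apply: quasiperiodicM; [apply: (quasiperiodic_shift 1 qsV)|apply: quasiperiodic_shift].
by rewrite /= TY !twistedE.
Qed.

Lemma shift_unroll (S : {rmorphism F -> F}) : is_shift X Y Z S ->
  forall k, S (x k) = x (k - 1) /\ S (y k) = y (k - 1).
Proof.
move=> [SX SY SZ] k; rewrite !unroll_rmorph SZ; split.
  apply: (eq_unroll (f := fun k => x (k - 1))) => [|i].
    exact/quasiperiodic_shift/unroll_quasiperiodic.
  by rewrite /= SX twistedE.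
apply: (eq_unroll (f := fun k => y (k - 1))) => [|i].
  exact/quasiperiodic_shift/unroll_quasiperiodic.
by rewrite /= SY twistedE.
Qed.

End Maps.
End Unrolling.

Section Substitutions.
Variables (n : nat) (n0 : (0 < n)%N) (F : unitAlgType rat).
Variable iota : {rmorphism free_algebra n -> F}.
Hypothesis hF : universal_field_of_fractions iota.
Let X (i : 'I_n) := iota (genX i).
Let Y (i : 'I_n) := iota (genY i).
Let Z := iota (genZ n).
Let x := unroll n0 X Z.
Let y := unroll n0 Y Z.

(* The specialization sending every variable to [1 : rat] sends each of the
   elements below to 1 or 2. *)
Lemma generic_units :
  [/\ Z \is a GRing.unit, forall k, y k \is a GRing.unit
    & forall k l, x k + y l \is a GRing.unit].
Proof.
have [_ _ _ univ] := hF; have skewQ : skew_field rat^o by move=> a; rewrite unitfE.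
have [K0 [phi sp]] := univ rat^o (free_eval (fun _ => 1 : rat^o)) skewQ.
have gen1 v : K0 (iota (gen v)) /\ phi (iota (gen v)) = 1.
  rewrite (spec_morph_base sp); split; first exact: (spec_base sp).
  exact: free_eval_gen.
have X1 i : K0 (X i) /\ phi (X i) = 1 by apply: gen1.
have Y1 i : K0 (Y i) /\ phi (Y i) = 1 by apply: gen1.
have [KZ Z1] : K0 Z /\ phi Z = 1 by apply: gen1.
have U A k : (forall i, K0 (A i) /\ phi (A i) = 1) ->
    K0 (unroll n0 A Z k) /\ phi (unroll n0 A Z k) = 1.
  move=> A1; rewrite /unroll /twisted.
  have [KA phiA] := A1 (cyclic_index (Ordinal n0) k).
  have Zq q : K0 (Z ^ q) /\ phi (Z ^ q) = 1.
    by have [|KZq ->] := specX sp q KZ; rewrite Z1 ?unitr1 // exp1rz.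
  set m := divz _ _; have [[KZm Zm1] [KZn Zn1]] := (Zq m, Zq (- m)).
  have [KM M1] := specM sp KZm KA; have [KN N1] := specM sp KM KZn.
  by split=> //; rewrite N1 M1 phiA Zm1 Zn1 !mulr1.
have unit1 a : K0 a /\ phi a = 1 -> a \is a GRing.unit.
  by move=> [Ka a1]; have [|] := specV sp Ka; rewrite ?a1 ?unitr1.
split=> [|k|k l]; [exact: unit1|by apply/unit1/U|].
have [[Kx x1] [Ky y1]] := (U X k X1, U Y l Y1).
have [Ks s2] := specD sp Kx Ky.
by have [|] := specV sp Ks; rewrite ?s2 ?x1 ?y1 // unitfE.
Qed.

(** [w] is a left inverse of [v]. Membership in [K0] is part of the condition, since [phi] is
    uncontrolled elsewhere; the condition is stable under differences and products, hence can be
    tested on variables. *)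
Lemma substitution_morphism (v w : variable n -> F) :
  (forall (K0 : F -> Prop) (phi : F -> F),
     specialization iota (free_eval w) K0 phi ->
     (forall u, phi (iota (gen u)) = w u) ->
     forall u, K0 (v u) /\ phi (v u) = iota (gen u)) ->
  exists T : {rmorphism F -> F}, forall u, T (iota (gen u)) = v u.
Proof.
move=> vw; have [|T TE] := @universal_endomorphism _ _ iota hF (free_eval v) (free_eval w).
  move=> K0 phi sp; apply: free_algebra_ind => [c|u|r r' [K1 e1] [K2 e2]|r r' [K1 e1] [K2 e2]].
  - have sc := spec_morph_base sp (malgC c); rewrite !rmorph_malgC in sc *.
    by split=> //; have := spec_base sp (malgC c); rewrite rmorph_malgC.
  - rewrite /= free_eval_gen; apply: (vw _ _ sp) => u'.
    by rewrite (spec_morph_base sp) /= free_eval_gen.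
  - by rewrite !rmorphB -e1 -e2 (spec_morph_sub sp) //; split=> //; apply: (spec_sub sp).
  - by rewrite !rmorphM -e1 -e2 (spec_morph_mul sp) //; split=> //; apply: (spec_mul sp).
by exists T => u; rewrite TE /= free_eval_gen.
Qed.

Lemma spec_unroll (h : {rmorphism free_algebra n -> F}) (K0 : F -> Prop) (phi : F -> F)
    (A B : 'I_n -> F) k :
  specialization iota h K0 phi -> (forall i, K0 (A i)) -> (forall i, phi (A i) = B i) ->
  phi Z = Z -> K0 (unroll n0 A Z k) /\ phi (unroll n0 A Z k) = unroll n0 B Z k.
Proof.
move=> sp KA phiA phiZ; have [uZ _ _] := generic_units.
have KZ : K0 Z by apply: (spec_base sp).
have Zq q : K0 (Z ^ q) /\ phi (Z ^ q) = Z ^ q.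
  by have := specX sp q KZ; rewrite phiZ; apply.
rewrite /unroll /twisted; set m := divz _ _; set i := cyclic_index _ _.
have [[KZm Zm] [KZn Zn]] := (Zq m, Zq (- m)).
have [KM M1] := specM sp KZm (KA i); have [KN N1] := specM sp KM KZn.
by split=> //; rewrite N1 M1 phiA Zm Zn.
Qed.

Lemma shift_exists : exists S : {rmorphism F -> F}, is_shift X Y Z S.
Proof.
have [uZ _ _] := generic_units.
pose images c (u : variable n) : F := match u with
  | inl (inl i) => x (i%:Z + c) | inl (inr i) => y (i%:Z + c) | inr _ => Z end.
(* Translation by 1 undoes translation by -1. *)
have [|S SE] := @substitution_morphism (images (-1)) (images 1).
  move=> K0 phi sp phiE.
  have KX i : K0 (X i) := spec_base sp _.
  have KY i : K0 (Y i) := spec_base sp _.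
  have phiZ : phi Z = Z := phiE (inr tt).
  have xE k : K0 (x k) /\ phi (x k) = x (k + 1).
    have [Kx ->] := spec_unroll k sp KX (fun i => phiE (inl (inl i))) phiZ.
    split=> //; apply: (eq_unroll n0 (f := fun k => x (k + 1))) => //.
    exact/quasiperiodic_shift/unroll_quasiperiodic.
  have yE k : K0 (y k) /\ phi (y k) = y (k + 1).
    have [Ky ->] := spec_unroll k sp KY (fun i => phiE (inl (inr i))) phiZ.
    split=> //; apply: (eq_unroll n0 (f := fun k => y (k + 1))) => //.
    exact/quasiperiodic_shift/unroll_quasiperiodic.
  case=> [[i|i]|[]] /=; last by split=> //; apply: (spec_base sp).
    by have [Kx ->] := xE (i%:Z - 1); rewrite subrK /x unroll_ord.
  by have [Ky ->] := yE (i%:Z - 1); rewrite subrK /y unroll_ord.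
exists S; split=> [i|i|]; rewrite ?twistedE.
- exact: (SE (inl (inl i))).
- exact: (SE (inl (inr i))).
- exact: (SE (inr tt)).
Qed.

(* Writing x', y' for the images of x, y, one has
   x'_k + y'_(k-1) = x_(k+2) + y_(k+2), so that the preimages are
   s_k x_k s_(k+2)^-1 and s_k y_(k-1) s_(k+2)^-1
   with s_k = x_(k-2) + y_(k-3). *)
Lemma pentagram_exists : exists T : {rmorphism F -> F}, is_pentagram_map X Y Z T.
Proof.
have [uZ uy us] := generic_units.
have qx : quasiperiodic n Z x by apply: unroll_quasiperiodic.
have qy : quasiperiodic n Z y by apply: unroll_quasiperiodic.
pose s k := x (k - 2) + y (k - 3).
have sE k : s (k + 2) = x k + y (k - 1).
  by rewrite /s addrK -addrA.
pose preX k := s k * x k * (s (k + 2))^-1.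
pose preY k := s k * y (k - 1) * (s (k + 2))^-1.
have qs : quasiperiodic n Z s.
  by apply: quasiperiodicD; [apply: (quasiperiodic_shift _ qx)|apply: (quasiperiodic_shift _ qy)].
have usk k : s k \is a GRing.unit by apply: us.
have qsV : quasiperiodic n Z (fun k => (s k)^-1) by apply: quasiperiodicV.
have qsV2 : quasiperiodic n Z (fun k => (s (k + 2))^-1) := quasiperiodic_shift 2 qsV.
have qX : quasiperiodic n Z preX by do 2![apply: quasiperiodicM => //].
have qY : quasiperiodic n Z preY.
  by do 2![apply: quasiperiodicM => //]; apply: quasiperiodic_shift.
pose images (u : variable n) : F := match u with
  | inl (inl i) => (x i%:Z + y i%:Z)^-1 * x i%:Z * (x (i%:Z + 2) + y (i%:Z + 2))
  | inl (inr i) => (x (i%:Z + 1) + y (i%:Z + 1))^-1 * y (i%:Z + 1)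
                   * (x (i%:Z + 3) + y (i%:Z + 3))
  | inr _ => Z end.
pose preimages (u : variable n) : F := match u with
  | inl (inl i) => preX i%:Z | inl (inr i) => preY i%:Z | inr _ => Z end.
have [|T TE] := @substitution_morphism (images) (preimages).
  move=> K0 phi sp phiE.
  have KX i : K0 (X i) := spec_base sp _.
  have KY i : K0 (Y i) := spec_base sp _.
  have phiZ : phi Z = Z := phiE (inr tt).
  have xE k : K0 (x k) /\ phi (x k) = preX k.
    have [Kx ->] := spec_unroll k sp KX (fun i => phiE (inl (inl i))) phiZ.
    by split=> //; apply: eq_unroll.
  have yE k : K0 (y k) /\ phi (y k) = preY k.
    have [Ky ->] := spec_unroll k sp KY (fun i => phiE (inl (inr i))) phiZ.
    by split=> //; apply: eq_unroll.
  (* The images of x_k and y_k add up to s_k (x_k + y_(k-1)) s_(k+2)^-1 = s_k, a unit, which puts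
     the inverse of x_k + y_k in [K0]. *)
  have xyE k : [/\ K0 (x k + y k), K0 (x k + y k)^-1,
      phi (x k + y k) = s k & phi (x k + y k)^-1 = (s k)^-1].
    have [[Kx phix] [Ky phiy]] := (xE k, yE k).
    have [Kxy phixy] := specD sp Kx Ky.
    have phis : phi (x k + y k) = s k.
      rewrite phixy phix phiy /preX /preY -mulrDl -mulrDr -sE.
      exact: mulrK (usk _) _.
    have [|_ KV phiV] := specV sp Kxy; first by rewrite phis usk.
    by rewrite -phis; split.
  have conjE a b k l : K0 a -> phi a = s k * b * (s l)^-1 ->
      let c := (x k + y k)^-1 * a * (x l + y l) in K0 c /\ phi c = b.
    move=> Ka phia; have [_ KV _ phiV] := xyE k; have [Kl _ phil _] := xyE l.
    have [K1 e1] := specM sp KV Ka; have [K2 e2] := specM sp K1 Kl.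
    split=> //; rewrite e2 e1 phiV phil phia !mulrA mulVr ?usk // mul1r.
    exact: mulrVK (usk _) _.
  case=> [[i|i]|[]] /=; last by split=> //; apply: (spec_base sp).
    have [Kx ex] := xE i%:Z; rewrite -[iota _](unroll_ord n0 Z X).
    exact: conjE.
  have [Ky ey] := yE (i%:Z + 1); rewrite -[iota _](unroll_ord n0 Z Y).
  by apply: conjE => //; rewrite ey /preY addrK -addrA.
exists T; split=> [i|i|]; rewrite ?twistedE ?addr0.
- exact: (TE (inl (inl i))).
- exact: (TE (inl (inr i))).
- exact: (TE (inr tt)).
Qed.

End Substitutions.

(** * Path sums as products of transfer matrices *)

Lemma big_tuple_cons (V : finType) (M : nmodType) k (P : pred (seq V)) (E : seq V -> M) :
  \sum_(p : k.+1.-tuple V | P p) E p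
    = \sum_(v : V) \sum_(p : k.-tuple V | P (v :: p)) E (v :: p).
Proof.
rewrite pair_big_dep /=.
rewrite (reindex (fun vp : V * k.-tuple V => cons_tuple vp.1 vp.2)) /=; last first.
  exists (fun p : k.+1.-tuple V => (thead p, behead_tuple p)) => [[v p] _|p _] /=.
    by rewrite theadE; congr pair; apply: val_inj.
  by rewrite [RHS]tuple_eta.
exact: eq_bigl.
Qed.

Section PathSums.
Variables (n : nat) (F : nzRingType) (X Y : 'I_n -> F) (Z : F).
Local Notation vert := (vertex n).
Local Notation arrow := (arrow X Y Z).
Local Notation weight := (edge_weight X Y Z).

Definition walk_sum k (u t : vert) : laurent F :=
  \sum_(p : k.-tuple vert | path arrow u p && (last u p == t)) path_weight X Y Z u p.

Definition path_sum (u t : vert) : laurent F := \sum_(k < #|{: vert}|) walk_sum k u t.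

Lemma boundary_measurementE s t :
  boundary_measurement X Y Z s t = path_sum (Source s) (Sink t).
Proof. by rewrite mxE. Qed.

(** A rank function witnessing acyclicity; inside a face the order is bl, tl, tr, br. *)
Definition level (u : vert) : nat :=
  match u with
  | Source _ => 0
  | Face i c => (4 * i + match c with BL => 1 | TL => 2 | TR => 3 | BR => 4 end)%N
  | Sink _ => (4 * n + 1)%N
  end.

Lemma arrow_level u v : arrow u v -> (level u < level v)%N.
Proof.
rewrite /Defs.arrow; case: u v => [s|s|i c] [s'|s'|j d] //=.
- by case: d => // _; rewrite addnS.
- by case: c.
- by have := ltn_ord i; case: c; case: (nat_of_ord s') => [|[|?]] //=; lia.
case: c d => [] [] //=; rewrite /when; case: eqP => //= -> //; lia.
Qed.

Lemma walk_sum0 u t : walk_sum 0 u t = (u == t)%:R.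
Proof.
rewrite /walk_sum (eq_bigl (fun p : 0.-tuple vert => u == t)).
  case: eqP => _; last by rewrite big1.
  by rewrite (big_pred1 [tuple]) // => p; rewrite [p]tuple0 /= eqxx.
by move=> p; rewrite tuple0.
Qed.

Lemma walk_sumS k u t : walk_sum k.+1 u t = \sum_v weight u v * walk_sum k v t.
Proof.
rewrite /walk_sum (big_tuple_cons k (fun p => path arrow u p && (last u p == t))
  (fun p => path_weight X Y Z u p)).
apply: eq_bigr => v _; rewrite mulr_sumr /=.
case uv : (arrow u v) => //=.
(* If u -> v is not an arrow, no path starts with it and its weight is 0. *)
rewrite big_pred0 //; symmetry; apply: big1 => p _.
by move: uv; rewrite /Defs.arrow /edge_weight; case: edge => // _; rewrite mul0r.
Qed.

(** Levels increase along a walk, so one with #|V| arrows would visit #|V| + 1 distinct vertices. *)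
Lemma long_walk_sum u t : walk_sum #|{: vert}| u t = 0.
Proof.
rewrite /walk_sum big_pred0 // => p; apply/negP => /andP[pp _].
have lev : path ltn (level u) (map level p).
  by rewrite path_map; apply: sub_path pp => v w; apply: arrow_level.
have uniq_p : uniq (u :: p).
  by apply: (@map_uniq _ _ level); apply: (sorted_uniq ltn_trans ltnn (lev : sorted ltn (map level (u :: p)))).
by have := max_card (mem (u :: p)); rewrite (card_uniqP uniq_p) /= size_tuple ltnn.
Qed.

(** Decomposition by the first arrow. It raises the length bound by one, which adds only a vanishing
    term. *)
Lemma path_sumE u t : path_sum u t = (u == t)%:R + \sum_v weight u v * path_sum v t.
Proof.
rewrite /path_sum; under [in RHS]eq_bigr do rewrite mulr_sumr.
rewrite exchange_big /=; under [in RHS]eq_bigr do rewrite -walk_sumS.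
transitivity (\sum_(k < #|{: vert}|.+1) walk_sum k u t).
  by rewrite big_ord_recr /= long_walk_sum addr0.
by rewrite big_ord_recl walk_sum0.
Qed.

Lemma sum_vertex (M : nmodType) (E : vert -> M) :
  \sum_v E v = \sum_s E (Source s) + \sum_s E (Sink s)
    + \sum_i (E (Face i TL) + E (Face i TR) + E (Face i BL) + E (Face i BR)).
Proof.
rewrite (reindex (@vertex_decode n)) /=; last first.
  by exists (@vertex_code n) => [[[s|s]|[i c]] _|[s|s|i c] _].
rewrite big_sumType big_sumType /=; congr (_ + _).
rewrite (eq_bigr (fun ic => E (Face ic.1 ic.2))) => [|[]//].
rewrite -(pair_bigA _ (fun i c => E (Face i c))) /=; apply: eq_bigr => i _.
rewrite (reindex corner_decode); last first.
  exists corner_code => [k _|c _]; last exact: corner_codeK.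
  by case: k => -[|[|[|[|//]]]] lt4; apply: val_inj; rewrite /corner_decode /= inordK.
by rewrite !big_ord_recl big_ord0 /= addr0 !addrA.
Qed.

Lemma sum_face (E : 'I_n -> laurent F) (k : nat) :
  \sum_(j < n) (if j == k :> nat then E j else 0) = oapp E 0 (insub k).
Proof.
case: insubP => [i _ ik|/negP kn] /=; last first.
  by apply: big1 => j _; case: eqP => // jk; case: kn; rewrite -jk.
rewrite (bigD1 i) //= ik eqxx big1 ?addr0 // => j ji.
by case: eqP => // jk; case/eqP: ji; apply: val_inj; rewrite /= ik.
Qed.

Section Recursion.
Variable t : 'I_3.
Local Notation P u := (path_sum u (Sink t)).

Lemma path_sum_sink s : P (Sink s) = (s == t)%:R.
Proof.
rewrite path_sumE big1 ?addr0 // => v _.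
by rewrite /edge_weight; case: v => [?|?|? []]; rewrite /= mul0r.
Qed.

Lemma path_sum_face u : P u = (u == Sink t)%:R + weight u (Sink t)
  + \sum_i (weight u (Face i TL) * P (Face i TL) + weight u (Face i TR) * P (Face i TR)
     + weight u (Face i BL) * P (Face i BL) + weight u (Face i BR) * P (Face i BR)).
Proof.
rewrite path_sumE sum_vertex -!addrA; congr (_ + _); rewrite big1 ?add0r.
  congr (_ + _); rewrite (bigD1 t) //= path_sum_sink eqxx mulr1 big1 ?addr0 // => s st.
  by rewrite path_sum_sink (negbTE st) mulr0.
by move=> s _; rewrite /edge_weight; case: u => [?|?|? []]; rewrite /= mul0r.
Qed.

Lemma weight_when b (w : F) e :
  (if when b w e is Some (c, k) then lterm c k else 0) = if b then lterm w e else 0.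
Proof. by case: b. Qed.

Lemma if_mul0 (b : bool) (x y : laurent F) :
  (if b then x else 0) * y = if b then x * y else 0.
Proof. by case: b; rewrite ?mul0r. Qed.

(** An index beyond the last face gives 0, so arrows leaving the last faces fit the general
    formula. *)
Definition face_sum c (k : nat) : laurent F := oapp (fun i => P (Face i c)) 0 (insub k).

Lemma path_sum_TL i : P (Face i TL) = P (Face i TR).
Proof.
rewrite path_sum_face /edge_weight /= !add0r.
under eq_bigr => j _ do
  rewrite !mul0r add0r !addr0 weight_when if_mul0 [_ * _]mul1r eq_sym.
by rewrite sum_face valK.
Qed.

Lemma path_sum_BR i : P (Face i BR) =
  (if ((t.+1 == 1) && (i.+1 == n))%N
   then lterm Z (if (3 %| n.+1)%N then 1 else 0) else 0)
  + lterm 1 (if (3 %| i.+2)%N then 1 else 0) * face_sum TL i.+1.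
Proof.
rewrite path_sum_face /edge_weight /= !add0r weight_when; congr (_ + _).
under eq_bigr => j _ do rewrite !mul0r !addr0 weight_when if_mul0.
rewrite (sum_face (fun j => lterm 1 (if (3 %| j.+1)%N then 1 else 0) * P (Face j TL))).
rewrite /face_sum; by case: insubP => [j _ /= ->|_] /=; rewrite ?mulr0.
Qed.

Lemma path_sum_TR i : P (Face i TR) =
  (if (t.+1 == 2)%N
   then if (i.+2 == n)%N then lterm Z (if (3 %| i.+1)%N then -1 else 0) else 0
   else if ((t.+1 == 3) && (i.+1 == n))%N
        then lterm Z (if (3 %| n)%N || (3 %| n.-1)%N then -1 else 0) else 0)
  + lterm 1 (if (3 %| i.+1)%N then -1 else 0) * face_sum BL i.+2 + P (Face i BR).
Proof.
rewrite path_sum_face /edge_weight /= !add0r -addrA; congr (_ + _).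
  by case: ifP => _; rewrite weight_when.
under eq_bigr => j _ do rewrite !mul0r !add0r !weight_when !if_mul0.
rewrite big_split /=; congr (_ + _).
  rewrite (sum_face (fun j => lterm 1 (if (3 %| i.+1)%N then -1 else 0) * P (Face j BL))).
  by rewrite /face_sum; case: insub => //=; rewrite mulr0.
under eq_bigr => j _ do rewrite [_ * _]mul1r eq_sym.
by rewrite sum_face valK.
Qed.

Lemma path_sum_BL i : P (Face i BL) =
  lterm (X i) 0 * P (Face i TL) + lterm (Y i) 0 * P (Face i BR).
Proof.
rewrite path_sum_face /edge_weight /= !add0r.
under eq_bigr => j _ do rewrite !mul0r !addr0 !weight_when !if_mul0 eq_sym.
rewrite big_split /=.
by rewrite (sum_face (fun j => lterm (X i) 0 * P (Face j TL)))
  (sum_face (fun j => lterm (Y i) 0 * P (Face j BR))) valK.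
Qed.

Lemma path_sum_source (s : 'I_3) : P (Source s) =
  if s == 0 :> nat then face_sum TL 0
  else if s == 1 :> nat then face_sum BL 0 else face_sum BL 1.
Proof.
rewrite path_sum_face /edge_weight /= !add0r.
under eq_bigr => j _ do rewrite !mul0r !addr0 !weight_when !if_mul0 ![_ * _]mul1r.
rewrite big_split /=.
have faceE m c : \sum_(j < n) (if j == m :> nat then P (Face j c) else 0) = face_sum c m.
  by rewrite (sum_face (fun j => P (Face j c))).
case: s => -[|[|[|//]]] ? /=; rewrite -faceE.
- by rewrite addrC big1 ?add0r.
- by rewrite big1 ?add0r //; apply: eq_bigr => j _; rewrite orbF.
by rewrite big1 ?add0r.
Qed.

End Recursion.
End PathSums.

(** * Transfer matrices and the monodromy of the network *)

Definition mat3 (A : nmodType) (rows : seq (seq A)) : 'M[A]_3 :=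
  \matrix_(i, j) nth 0 (nth [::] rows i) j.

Ltac mat3_entries :=
  apply/matrixP => -[[|[|[|//]]] ?] [[|[|[|//]]] ?];
  rewrite !mxE ?big_ord_recl ?big_ord0 ?mxE /= ?mulr0 ?mul0r ?mulr1 ?mul1r
    ?mulr0n ?mulr1n ?addr0 ?add0r.

(* Rows: paths entering face k at tl_k or bl_k, or bypassing it towards bl_(k+1);
   columns: tl_(k+1), bl_(k+1), bl_(k+2). *)
Definition lax (A : nzRingType) (a b : A) : 'M[A]_3 :=
  mat3 [:: [:: 1; 0; 1]; [:: a + b; 0; a]; [:: 0; 1; 0]].

Section LaxMatrices.
Variable F : nzRingType.
Implicit Types (a b c z : F).

Definition diag_gauge (e : int) : 'M[laurent F]_3 :=
  mat3 [:: [:: 1; 0; 0]; [:: 0; lterm 1 e; 0]; [:: 0; 0; lterm 1 e]].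

Lemma diag_gaugeM e f : diag_gauge e *m diag_gauge f = diag_gauge (e + f).
Proof. by mat3_entries; rewrite ?ltermM ?mulr1. Qed.

Lemma diag_gauge0 : diag_gauge 0 = 1%:M.
Proof. by mat3_entries. Qed.

(** The exponent counts the downward crossings of the arrows leaving the br_k, including the one to
    sink 1. *)
Definition monodromy n (x y : int -> F) z : 'M[laurent F]_3 :=
  (\prod_(k < n) lax (lterm (x k%:Z) (-1)) (lterm (y k%:Z) (-1))) *m (lterm z (n.+1 %/ 3)%N%:Z)%:M.

Lemma prod_mulmx_chain m r (U : nat -> 'M[laurent F]_m.+1) (V : nat -> 'M_(m.+1, r)) n :
  (forall k, (k < n)%N -> U k *m V k.+1 = V k) -> (\prod_(k < n) U k) *m V n = V 0%N.
Proof.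
elim: n => [|n ih] UV; first by rewrite big_ord0 mul1mx.
rewrite big_ord_recr /= -mulmxE -mulmxA UV // ih // => k kn.
by apply: UV; apply: ltnW.
Qed.

End LaxMatrices.

Section NetworkMonodromy.
Variables (n : nat) (F : nzRingType) (X Y : 'I_n -> F) (Z : F).
Hypothesis n2 : (2 <= n)%N.
Variables x y : int -> F.
Hypothesis xE : forall i : 'I_n, x i%:Z = X i.
Hypothesis yE : forall i : 'I_n, y i%:Z = Y i.

Let third (k : nat) : int := (k %/ 3)%N%:Z.
Let sink (t : 'I_3) (s : nat) (e : int) : laurent F := if t == s :> nat then lterm Z e else 0.

(* The sums of the weights of the paths from tl_k and bl_k to sink t, in a gauge
   in which each of the arrows out of bl_k carries lambda^-1 and no other arrow
   meets the cut; tl_(n+1), bl_(n+1), bl_(n+2) stand for the sinks. *)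
Definition top_sum (t : 'I_3) (k : nat) : laurent F :=
  if (k < n)%N then lterm 1 (third k.+1) * face_sum X Y Z t TL k
  else sink t 0 (third n.+1).

Definition bottom_sum (t : 'I_3) (k : nat) : laurent F :=
  if (k < n)%N then lterm 1 (third k.+1 - 1) * face_sum X Y Z t BL k
  else sink t (k - n).+1 (third n.+1 - 1).

Lemma face_sumE t c (i : 'I_n) : face_sum X Y Z t c i = path_sum X Y Z (Face i c) (Sink t).
Proof. by rewrite /face_sum valK. Qed.

Lemma face_sum_out t c k : (n <= k)%N -> face_sum X Y Z t c k = 0.
Proof. by move=> nk; rewrite /face_sum; case: insubP => //= i; rewrite ltnNge nk. Qed.

(** [third] jumps exactly where the arrow out of br crosses the cut, so the gauge absorbs the
    crossing. *)
Lemma top_sumS t (i : 'I_n) :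
  lterm 1 (third i.+1) * path_sum X Y Z (Face i BR) (Sink t) = top_sum t i.+1.
Proof.
rewrite path_sum_BR /top_sum /sink eqSS; case: (ltnP i.+1 n) => [i1n|ni1].
  rewrite (ltn_eqF i1n) andbF add0r mulrA ltermM mulr1; congr (lterm _ _ * _).
  by rewrite /third; case: ifP; lia.
have ni : i.+1 = n by have := ltn_ord i; lia.
rewrite face_sum_out // mulr0 addr0 ni eqxx andbT; case: eqP => _; last by rewrite mulr0.
by rewrite ltermM mul1r; congr lterm; rewrite /third; case: ifP; lia.
Qed.

Lemma bottom_sumSS t (i : 'I_n) :
  lterm 1 (third i.+1) * path_sum X Y Z (Face i TR) (Sink t)
    = top_sum t i.+1 + bottom_sum t i.+2.
Proof.
rewrite path_sum_TR mulrDr top_sumS addrC; congr (_ + _).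
rewrite /bottom_sum /sink; case: (ltnP i.+2 n) => [i2n|ni2].
  rewrite (ltn_eqF i2n) (ltn_eqF (ltnW i2n)) andbF if_same add0r mulrA ltermM mulr1.
  by congr (lterm _ _ * _); rewrite /third; case: ifP; lia.
rewrite face_sum_out // mulr0 addr0 !eqSS.
(* The last face leads to sink 3, the one before to sink 2. The rotation of the last arrows makes
   the exponent [third n.+1 - 1] in every residue of n mod 3. *)
have := ltn_ord i; rewrite leq_eqVlt => /orP[/eqP ni|i1n].
  rewrite ni subSnn eqxx andbT (gtn_eqF (ltnSn n)).
  case: (t =P 1%N :> nat) => [->|_] /=; first by rewrite mulr0.
  case: eqP => _; last by rewrite mulr0.
  by rewrite ltermM mul1r; congr lterm; rewrite /third; case: ifP; lia.
have ni : i.+2 = n by lia.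
rewrite ni subnn eqxx [i.+1 == n]ltn_eqF // andbF.
case: eqP => _; last by rewrite mulr0.
by rewrite ltermM mul1r; congr lterm; rewrite /third; case: ifP; lia.
Qed.

Lemma top_sum_rec t k : (k < n)%N -> top_sum t k = top_sum t k.+1 + bottom_sum t k.+2.
Proof.
move=> kn; pose i := Ordinal kn; rewrite -[k]/(nat_of_ord i) -bottom_sumSS.
by rewrite {1}/top_sum ltn_ord face_sumE path_sum_TL.
Qed.

Lemma bottom_sum_rec t k : (k < n)%N ->
  bottom_sum t k = lterm (x k + y k) (-1) * top_sum t k.+1 + lterm (x k) (-1) * bottom_sum t k.+2.
Proof.
move=> kn; pose i := Ordinal kn; rewrite -[k]/(nat_of_ord i) xE yE.
(* Regrouped as x_k (top + bottom) + y_k top: X leads on to tr_k, and Y to br_k. *)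
rewrite ltermD mulrDl addrAC -mulrDr -bottom_sumSS -top_sumS !mulrA !ltermM !mulr1.
rewrite {1}/bottom_sum ltn_ord face_sumE path_sum_BL path_sum_TL mulrDr !mulrA !ltermM.
by rewrite !mul1r !addr0 [-1 + _]addrC.
Qed.

Lemma gauged_boundary_measurement :
  diag_gauge F (-1) *m boundary_measurement X Y Z
    = monodromy n x y Z *m diag_gauge F (-1).
Proof.
(* The rows are the three entry points tl_k, bl_k, bl_(k+1): the sources at k = 0, the sinks at k =
   n. *)
pose V (k : nat) : 'M[laurent F]_3 :=
  \matrix_(i, t) nth 0 [:: top_sum t k; bottom_sum t k; bottom_sum t k.+1] i.
have VS k : (k < n)%N -> lax (lterm (x k) (-1)) (lterm (y k) (-1)) *m V k.+1 = V k.
  move=> kn; apply/matrixP => i t; rewrite !mxE !big_ord_recl big_ord0 !mxE /=.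
  case: i => [[|[|[|//]]] ?] /=; rewrite ?mul1r ?mul0r ?add0r ?addr0.
  - by rewrite [RHS]top_sum_rec.
  - by rewrite [RHS]bottom_sum_rec // ltermD.
  - by [].
have V0 : V 0%N = diag_gauge F (-1) *m boundary_measurement X Y Z.
  apply/matrixP => i t; rewrite !mxE !big_ord_recl big_ord0 !boundary_measurementE.
  rewrite !path_sum_source /= !mxE /= /top_sum /bottom_sum (ltnW n2) n2.
  by case: i => [[|[|[|//]]] ?] /=; rewrite ?mul1r ?mul0r ?add0r ?addr0.
have Vn : V n = (lterm Z (third n.+1))%:M *m diag_gauge F (-1).
  apply/matrixP => i t; rewrite !mxE !big_ord_recl big_ord0 !mxE /= /top_sum /bottom_sum.
  rewrite ltnn ltnNge leqnSn /= subnn subSnn /sink.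
  by case: i t => [[|[|[|//]]] ?] [[|[|[|//]]] ?] /=;
    rewrite ?mulr1n ?mulr0n ?mul0r ?mulr0 ?add0r ?addr0 ?mulr1 ?ltermM ?mulr1.
rewrite -V0 /monodromy -mulmxA -Vn; symmetry.
exact: (prod_mulmx_chain (U := fun k : nat => lax (lterm (x k) (-1)) (lterm (y k) (-1))) VS).
Qed.

Lemma trace_boundary_measurement k :
  coef_commutators (\tr (boundary_measurement X Y Z ^+ k) - \tr (monodromy n x y Z ^+ k)).
Proof.
have gK e : diag_gauge F (- e) *m diag_gauge F e = 1%:M.
  by rewrite diag_gaugeM addNr diag_gauge0.
have gVK : diag_gauge F (-1) *m diag_gauge F 1 = 1%:M := gK 1.
have gKV : diag_gauge F 1 *m diag_gauge F (-1) = 1%:M := gK (-1).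
exact: mxtrace_expr_conj_mod gVK gKV (esym gauged_boundary_measurement).
Qed.

End NetworkMonodromy.

(** * The pentagram map and the shift on transfer matrices *)

Section PentagramGauge.
Variable A : nzRingType.
Implicit Types (s w x y z : A).

(* Solutions (a_k, b_k, b_(k+1)) of the recursion
   a_k = a_(k+1) + b_(k+2), b_k = s_k a_(k+1) + x_k b_(k+2) given by
   the matrices [lax] are sent to solutions of the recursion for T(x), T(y) by
   a'_k = s_(k+2)^-1 b_(k+2). The matrix below expresses the former in terms of
   the latter, for s0 = s_k, s1 = s_(k+1), w = s_k^-1 y_k s_(k+2). *)
Definition pentagram_gauge s0 s1 w : 'M[A]_3 :=
  mat3 [:: [:: 1 + w; 1; 1]; [:: s0; s0; s0]; [:: s1; 0; s1]].

Definition pentagram_gaugeV s0V s1V wV : 'M[A]_3 :=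
  mat3 [:: [:: wV; - (wV * s0V); 0]; [:: 0; s0V; - s1V]; [:: - wV; wV * s0V; s1V]].

Lemma pentagram_gaugeK s0 s1 w s0V s1V wV :
  s0 * s0V = 1 -> s1 * s1V = 1 -> w * wV = 1 ->
  pentagram_gauge s0 s1 w *m pentagram_gaugeV s0V s1V wV = 1%:M.
Proof.
move=> es0 es1 ew; mat3_entries.
all: rewrite ?mulrDl ?mul1r ?mulrN ?mulNr ?mulrA ?ew ?es0 ?es1 ?subrr ?mul1r //.
- by rewrite addrAC subrr add0r.
- by rewrite -opprD [s0V + _]addrC addNr.
- by rewrite addNr.
- by rewrite addrCA addNr addr0.
- by rewrite addNr.
by rewrite addNr.
Qed.

Lemma pentagram_gaugeVK s0 s1 w s0V s1V wV :
  s0V * s0 = 1 -> s1V * s1 = 1 -> wV * w = 1 ->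
  pentagram_gaugeV s0V s1V wV *m pentagram_gauge s0 s1 w = 1%:M.
Proof.
move=> es0 es1 ew; mat3_entries.
all: rewrite ?mulrDr ?mulr1 ?mulrN ?mulNr -?mulrA ?ew ?es0 ?es1 ?subrr ?mulr1 //.
- by rewrite addrAC subrr add0r.
- by rewrite subrr.
- by rewrite subrr.
- by rewrite -opprD addNr.
- by rewrite addNr.
by rewrite addrA addNr add0r.
Qed.

(** The inverse in the formula for x' is cleared, and each hypothesis is homogeneous, so all three
    survive rescaling by lambda^-1. *)
Lemma lax_pentagram x0 y0 s0 s1 s2 w0 w1 x0' :
  x0 + y0 = s0 -> s0 * x0' = x0 * s2 -> x0' + w0 = s2 ->
  lax x0 y0 *m pentagram_gauge s1 s2 w1
    = pentagram_gauge s0 s1 w0 *m lax x0' w1.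
Proof.
move=> es e1 e2; mat3_entries.
all: rewrite ?es ?mulrDr ?mulr1 ?mul1r ?e1 //.
- by rewrite -e2 -!addrA; congr (1 + _); rewrite addrCA [RHS]addrCA [w1 + w0]addrC.
- by rewrite -e2 -addrA [w0 + _]addrC.
by rewrite -addrA [s0 * w1 + _]addrC.
Qed.

End PentagramGauge.

Lemma mulmx_scalar_intertwine (A : nzRingType) m (P Q : 'M[A]_m) (z : A) :
  (forall i j, P i j * z = z * Q i j) -> P *m z%:M = z%:M *m Q.
Proof.
move=> PQ; apply/matrixP => i j; rewrite !mxE (bigD1 j) //= [in RHS](bigD1 i) //=.
rewrite !mxE !eqxx !mulr1n PQ !big1 ?addr0 // => k ki; rewrite mxE.
  by rewrite [i == k]eq_sym (negbTE ki) mul0r.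
by rewrite (negbTE ki) mulr0.
Qed.

Lemma prod_mulmx_intertwine (A : nzRingType) m (U V H : nat -> 'M[A]_m.+1) n :
  (forall k, U k *m H k.+1 = H k *m V k) ->
  (\prod_(k < n) U k) *m H n = H 0%N *m \prod_(k < n) V k.
Proof.
move=> UV; elim: n => [|n ih]; first by rewrite !big_ord0 mul1mx mulmx1.
by rewrite !big_ord_recr /= -!mulmxE -mulmxA UV mulmxA ih mulmxA.
Qed.

(** The last factor of [U], moved across [c], becomes the first factor of [V]; the two products are
    then ab and ba. *)
Lemma prod_rotate (A : pzRingType) (U V : nat -> A) c m :
  (forall k, V k.+1 = U k) -> U m * c = c * V 0%N ->
  (\prod_(k < m.+1) V k) * c = V 0%N * ((\prod_(k < m) U k) * c) /\
  (\prod_(k < m.+1) U k) * c = ((\prod_(k < m) U k) * c) * V 0%N.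
Proof.
move=> VU Uc; split; last by rewrite big_ord_recr /= -!mulrA Uc.
rewrite big_ord_recl /= -mulrA; congr (_ * (_ * _)).
by apply: eq_bigr => k _; rewrite VU.
Qed.

Section MonodromyInvariance.
Variables (n : nat) (F : unitRingType) (x y : int -> F) (Z : F).
Hypothesis uZ : Z \is a GRing.unit.
Hypotheses (qx : quasiperiodic n Z x) (qy : quasiperiodic n Z y).
Let L (a : F) : laurent F := lterm a (-1).
Let z : laurent F := lterm Z (n.+1 %/ 3)%N%:Z.

Lemma quasiperiodic_mulZ f k : quasiperiodic n Z f -> f (k + n%:Z) * Z = Z * f k.
Proof.
by move=> qf; have := qf k 1; rewrite mul1r expr1z exprN1 => ->; rewrite mulrVK.
Qed.

Lemma lterm_mulZ f k : quasiperiodic n Z f -> L (f (k + n%:Z)) * z = z * L (f k).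
Proof. by move=> qf; rewrite !ltermM quasiperiodic_mulZ // addrC. Qed.

Lemma trace_monodromy_shift i : (0 < n)%N -> coef_commutators
  (\tr (monodromy n (fun k => x (k - 1)) (fun k => y (k - 1)) Z ^+ i)
   - \tr (monodromy n x y Z ^+ i)).
Proof.
case: n qx qy @z lterm_mulZ => // m qx' qy' z' zM _.
pose U (k : int) := lax (L (x k)) (L (y k)).
(* Moving past Z lowers the index by the period m + 1, from m to -1. *)
have Uz : U m *m z'%:M = z'%:M *m U (-1).
  have em : m%:Z = -1 + m.+1%:Z by lia.
  have [ex ey] := (zM _ (-1) qx', zM _ (-1) qy'); rewrite -em in ex ey.
  apply: mulmx_scalar_intertwine => -[[|[|[|//]]] ?] [[|[|[|//]]] ?];
    by rewrite !mxE /= ?mulr0 ?mul0r ?mulr1 ?mul1r ?mulrDl ?mulrDr ?ex ?ey.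
have ek (k : nat) : U (k.+1%:Z - 1) = U k by congr U; lia.
have [e1 e2] := prod_rotate (U := fun k : nat => U k) (V := fun k : nat => U (k%:Z - 1))
  ek Uz.
have -> : monodromy m.+1 (fun k => x (k - 1)) (fun k => y (k - 1)) Z
  = U (0 - 1) * ((\prod_(k < m) U k) * z'%:M) := e1.
have -> : monodromy m.+1 x y Z = ((\prod_(k < m) U k) * z'%:M) * U (0 - 1) := e2.
exact: mxtrace_exprC_mod.
Qed.

Let s k := x k + y k.
(** This is the image of y_(k-1) under the pentagram map. *)
Let w k := (s k)^-1 * y k * s (k + 2).
Hypotheses (us : forall k, s k \is a GRing.unit) (uy : forall k, y k \is a GRing.unit).

Lemma trace_monodromy_pentagram i : coef_commutators
  (\tr (monodromy n (fun k => (s k)^-1 * x k * s (k + 2)) (fun k => w (k + 1)) Z ^+ i)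
   - \tr (monodromy n x y Z ^+ i)).
Proof.
set W' := monodromy n _ _ Z; set W := monodromy n x y Z.
have qs : quasiperiodic n Z s by apply: quasiperiodicD.
have qw : quasiperiodic n Z w.
  apply: quasiperiodicM => //; last exact: quasiperiodic_shift.
  by apply: quasiperiodicM => //; apply: quasiperiodicV.
pose H (k : int) := pentagram_gauge (L (s k)) (L (s (k + 1))) (L (w k)).
have step (k : nat) : lax (L (x k)) (L (y k)) *m H k.+1
    = H k *m lax (L ((s k)^-1 * x k * s (k%:Z + 2))) (L (w (k%:Z + 1))).
  have -> : k.+1%:Z = k%:Z + 1 by lia.
  rewrite /H -[k%:Z + 1 + 1]addrA; apply: lax_pentagram.
  - by rewrite /L -ltermD.
  - by rewrite /L !ltermM !mulrA mulrV ?us // mul1r.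
  - by rewrite /L -ltermD -!mulrDl -mulrDr mulVr ?us // mul1r.
have HZ : H n *m z%:M = z%:M *m H 0.
  have [e0 ew] := (lterm_mulZ 0 qs, lterm_mulZ 0 qw).
  have e1 := lterm_mulZ 1 qs; rewrite addrC in e1; rewrite add0r in e0 ew.
  apply: mulmx_scalar_intertwine => -[[|[|[|//]]] ?] [[|[|[|//]]] ?];
    by rewrite !mxE /= ?mulr0 ?mul0r ?mulr1 ?mul1r ?mulrDl ?mulrDr ?mulr1 ?mul1r ?e0 ?e1 ?ew.
have WH : W *m H 0 = H 0 *m W'.
  rewrite /W /W' /monodromy -mulmxA -HZ !mulmxA; congr (_ *m _).
  exact: (prod_mulmx_intertwine (H := fun k : nat => H k) n step).
(* The variables in [H] carry lambda^-1, so their inverses carry lambda. *)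
pose G := pentagram_gaugeV (lterm (s 0)^-1 1) (lterm (s 1)^-1 1) (lterm (w 0)^-1 1).
have uw : w 0 \is a GRing.unit by rewrite !unitrMl ?unitrV ?us ?uy.
have HG : H 0 *m G = 1%:M.
  by apply: pentagram_gaugeK; rewrite ltermM divrr ?us.
have GH : G *m H 0 = 1%:M.
  by apply: pentagram_gaugeVK; rewrite ltermM mulVr ?us.
exact: mxtrace_expr_conj_mod HG GH WH.
Qed.

End MonodromyInvariance.

Lemma mx_coef_image_monodromy n (F : nzRingType) (T : {rmorphism F -> F})
    (x y x' y' : int -> F) (Z : F) :
  (forall k, T (x k) = x' k) -> (forall k, T (y k) = y' k) -> T Z = Z ->
  mx_coef_image T (monodromy n x y Z) (monodromy n x' y' Z).
Proof.
move=> Tx Ty TZ; have image1 : coef_image T 1 1.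
  by have := coef_image_lterm T 1 0; rewrite rmorph1.
apply: mx_coef_imageM; last first.
  move=> i j; rewrite !mxE; case: (i == j); last exact: coef_image0.
  by rewrite !mulr1n -{2}TZ; apply: coef_image_lterm.
pose U (x y : int -> F) (k : nat) := lax (lterm (x k) (-1)) (lterm (y k) (-1)).
apply: (mx_coef_image_prod n (P := U x y) (P' := U x' y')) => k.
move=> -[[|[|[|//]]] ?] [[|[|[|//]]] ?];
  rewrite !mxE //= -?ltermD -?Tx -?Ty -?rmorphD;
  by [exact: coef_image0|exact: coef_image_lterm].
Qed.

Lemma trace_coef_invariant n (F : nzRingType) (X Y : 'I_n -> F) (Z : F)
    (x y x' y' : int -> F) (R : {rmorphism F -> F}) i j :
  (2 <= n)%N -> (forall k : 'I_n, x k%:Z = X k) -> (forall k : 'I_n, y k%:Z = Y k) ->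
  R Z = Z -> (forall k, R (x k) = x' k) -> (forall k, R (y k) = y' k) ->
  coef_commutators (\tr (monodromy n x' y' Z ^+ i) - \tr (monodromy n x y Z ^+ i)) ->
  commutator_sum (R (trace_coef X Y Z i j) - trace_coef X Y Z i j).
Proof.
move=> hn xE yE RZ Rx Ry RW; rewrite /trace_coef.
apply: lcoef_image_invariant RW; first exact: trace_boundary_measurement.
exact/coef_image_mxtrace_expr/mx_coef_image_monodromy.
Qed.

Theorem theorem13 (n : nat) (hn : (2 <= n)%N) (F : unitAlgType rat)
    (iota : {rmorphism free_algebra n -> F})
    (hF : universal_field_of_fractions iota) :
  let X := fun i : 'I_n => iota (genX i) in
  let Y := fun i : 'I_n => iota (genY i) in
  let Z := iota (genZ n) in
  [/\ exists T : {rmorphism F -> F}, is_pentagram_map X Y Z T,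
      exists S : {rmorphism F -> F}, is_shift X Y Z S
    & forall T S : {rmorphism F -> F},
        is_pentagram_map X Y Z T -> is_shift X Y Z S ->
        forall (i : nat) (j : int), (1 <= i)%N ->
        let t := trace_coef X Y Z i j in
        eq_mod_commutators (T t) t /\ eq_mod_commutators (S (S (T t))) t].
Proof.
move=> X Y Z; have n0 : (0 < n)%N := ltnW hn.
have [uZ uy us] := generic_units n0 hF.
split; [exact: (pentagram_exists n0 hF)|exact: (shift_exists n0 hF)|].
move=> T S pT sS i j _ t.
pose x := unroll n0 X Z; pose y := unroll n0 Y Z.
have qx : quasiperiodic n Z x by apply: unroll_quasiperiodic.
have qy : quasiperiodic n Z y by apply: unroll_quasiperiodic.
have xE : forall k : 'I_n, x k%:Z = X k := unroll_ord n0 Z X.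
have yE : forall k : 'I_n, y k%:Z = Y k := unroll_ord n0 Z Y.
have Tt : commutator_sum (T t - t).
  have TE := pentagram_unroll uZ (fun k => us k k) pT.
  apply: (trace_coef_invariant j hn xE yE _ _ _ (trace_monodromy_pentagram uZ qx qy (fun k => us k k) uy i)) => [|k|k].
  - by case: pT.
  - exact: (TE k).1.
  - by rewrite (TE k).2 -addrA.
have St : commutator_sum (S t - t).
  have SE := shift_unroll n0 uZ sS.
  apply: (trace_coef_invariant j hn xE yE _ _ _ (trace_monodromy_shift uZ qx qy i n0)) => [|k|k].
  - by case: sS.
  - exact: (SE k).1.
  - exact: (SE k).2.
split; apply: eq_mod_commutatorsP => //.
(* Telescoping through S(S(t)) and S(t). *)
have -> : S (S (T t)) - t = S (S (T t - t)) + S (S t - t) + (S t - t).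
  by rewrite !rmorphB !addrA !subrK.
apply: commutator_sumD => //.
by apply: commutator_sumD; do ?apply: commutator_sum_rmorph.
Qed.
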